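(* Let $\Theta=[a,b]$ be a finite interval partitioned into $\Lambda_1,\dots,\Lambda_N$ with points $\bar h_i\in\Lambda_i$, let $\gamma>0$, and let $\sigma_{A,i},\sigma_{B,i},\sigma_{C,i},\sigma_{Q,i}>0$ be scalars such that, for $\mu$-almost all $\ell\in\Lambda_i$ and all $i=1,\dots,N$, $$\|A(\ell)-A_i\|\le\sigma_{A,i},\quad \|B(\ell)-B_i\|\le\sigma_{B,i},\quad \|C(\ell)-C_i\|\le\sigma_{C,i},\quad \|Q(\ell)-Q_i\|\le\sigma_{Q,i}.$$ If the LMI-Problem (defined in the context) with these scalars and this $\gamma$ is feasible, then there exists $P\in\mathcal{H}^{n+*}_\infty$ such that $\Xi(\ell)\gg0$ $\mu$-a.e., where $$\Xi(\ell)=\begin{bmatrix}\mathcal{E}(P)(\ell)^{-1} & 0 & A(\ell) & B(\ell)\\ 0 & I & C(\ell) & 0\\ A(\ell)^{T} & C(\ell)^{T} & P(\ell) & 0\\ B(\ell)^{T} & 0 & 0 & \gamma I\end{bmatrix}.$$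
   Context: $\Theta=[a,b]$, $a<b$ real, with Borel $\sigma$-algebra and a $\sigma$-finite measure $\mu$. Matrices carry the spectral norm. $\mathcal{H}^{n\times m}_{\infty}$: measurable $P:\Theta\to\mathbb{R}^{n\times m}$ with $\operatorname{ess\,sup}_\ell\|P(\ell)\|<\infty$. ''$M(\ell)\gg0$ $\mu$-a.e.'' means there is $\xi>0$ with $M(\ell)\ge\xi I$ $\mu$-a.e.; $\mathcal{H}^{n+*}_\infty$: symmetric-valued $P\in\mathcal{H}^{n\times n}_\infty$ with $P(\ell)\gg0$ $\mu$-a.e. $A\in\mathcal{H}^{n\times n}_\infty$, $B\in\mathcal{H}^{n\times r}_\infty$, $C\in\mathcal{H}^{r\times n}_\infty$. $\{\vartheta(k)\}$ is a Markov chain in $\Theta$ with initial density $\nu_0>0$ $\mu$-a.e. and transition kernel $\mathbb{G}(\ell,\Lambda)=\int_\Lambda g(\ell,t)\mu(dt)$, with $\int_\Theta g(t,\ell)\mu(dt)>0$ $\mu$-a.e.; $\mathcal{E}(P)(\ell)=\int_\Theta g(\ell,t)P(t)\mu(dt)$. Grid: $a=h_0<h_1<\dots<h_N=b$; $\Lambda_i=[h_{i-1},h_i)$ for $i\le N-1$, $\Lambda_N=[h_{N-1},h_N]$; $\bar h_i\in\Lambda_i$. $q_i(\ell)=\int_{\Lambda_i}g(\ell,t)\mu(dt)$; $Q(\ell)=[\sqrt{q_1(\ell)}I_n\ \cdots\ \sqrt{q_N(\ell)}I_n]\in\mathbb{R}^{n\times nN}$; $A_i=A(\bar h_i)$, $B_i=B(\bar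 h_i)$, $C_i=C(\bar h_i)$, $Q_i=Q(\bar h_i)$. LMI-Problem: given $\gamma>0$ and positive scalars $\sigma_{A,i},\sigma_{B,i},\sigma_{C,i},\sigma_{Q,i}$, find, for $i=1,\dots,N$, nonsingular $X_i\in\mathbb{R}^{n\times n}$, symmetric positive definite $P_i\in\mathbb{R}^{n\times n}$, and scalars $\alpha_i,\beta_i,\rho_i>0$ such that $\Pi^1_i>0$ for all $i=1,\dots,N$. Here $\Upsilon=\mathrm{diag}\{P_1,\dots,P_N\}$ and $\Pi^1_i$ is the symmetric $14\times14$ block matrix with block sizes $(n,r,n,r,nN,r,n,n,n,r,r,nN,n,r)$, with diagonal blocks, in order, $X_i+X_i^T,\ I,\ P_i,\ \gamma I,\ \Upsilon,\ 2\alpha_iI,\ 2\alpha_iI,\ \alpha_iI,\ \beta_iI,\ \beta_iI,\ \beta_iI,\ \rho_iI,\ \rho_iI,\ \rho_iI$, with the following blocks above the diagonal (position: value): $(1,3)$: $X_iA_i$; $(1,4)$: $X_iB_i$; $(1,5)$: $Q_i\Upsilon$; $(1,7)$: $2\sigma_{A,i}X_i$; $(1,9)$: $\sigma_{B,i}X_i$; $(1,13)$: $\rho_iI$; $(2,3)$: $C_i$; $(2,6)$: $2\sigma_{C,i}I$; $(2,14)$: $\rho_iI$; $(3,8)$: $\alpha_iI$; $(4,11)$: $\beta_iI$; $(5,12)$: $\sigma_{Q,i}\Upsilon$; all other blocks above the diagonal zero, and blocks below the diagonal given by symmetry. *)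

(* Defs.v *)
From mathcomp Require Import all_boot all_order all_algebra.
From mathcomp Require Import all_classical all_reals all_analysis.
From mathcomp Require Import ess_sup_inf.
Set Implicit Arguments.
Unset Strict Implicit.
Unset Printing Implicit Defensive.
Import Order.TTheory GRing.Theory Num.Theory.
Import numFieldNormedType.Exports.
Local Open Scope classical_set_scope.
Local Open Scope ring_scope.

Section Matrices.
Context {R : realType}.

Definition eucl_norm n (x : 'cV[R]_n) : R := Num.sqrt (\sum_i x i 0 ^+ 2).

Definition spectral_norm m n (M : 'M[R]_(m, n)) : R :=
  sup [set eucl_norm (M *m x) | x in [set x : 'cV[R]_n | eucl_norm x <= 1]].

Definition quad_form n (M : 'M[R]_n) (x : 'cV[R]_n) : R := (x^T *m M *m x) 0 0.

Definition pos_def n (M : 'M[R]_n) : Prop :=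
  M^T = M /\ forall x, x != 0 -> 0 < quad_form M x.

Definition pos_semidef n (M : 'M[R]_n) : Prop :=
  M^T = M /\ forall x, 0 <= quad_form M x.

(* Adds a leading block row [D U] to the symmetric block matrix S; the blocks
   below the diagonal are filled in by symmetry. *)
Definition sym_border m n (D : 'M[R]_m) (U : 'M[R]_(m, n)) (S : 'M[R]_n) :
  'M[R]_(m + n) := block_mx D U U^T S.

End Matrices.

(* Theta is used as a Borel subset of the real line: the measure mu lives on
   the line, but only its trace on Theta is ever used. *)
Section Coefficients.
Context {R : realType} (Theta : set R)
  (mu : {measure set (measurableTypeR R) -> \bar R}).

(* Measurability is entrywise; the norm is extended by 0 outside Theta, so that
   the essential supremum is the one over Theta. *)
Definition Hinf m n (P : R -> 'M[R]_(m, n)) : Prop :=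
  (forall i j, measurable_fun Theta (fun l : measurableTypeR R => P l i j)) /\
  (ess_sup mu (patch (fun=> 0) Theta (fun l => (spectral_norm (P l))%:E))
     < +oo)%E.

Definition unif_pos n (M : R -> 'M[R]_n) : Prop :=
  exists2 xi : R, 0 < xi &
    {ae mu, forall l, Theta l -> pos_semidef (M l - xi%:M)}.

Definition Hinf_pos n (P : R -> 'M[R]_n) : Prop :=
  [/\ Hinf P, forall l, Theta l -> (P l)^T = P l & unif_pos P].

Definition transition_density (g : R -> R -> R) : Prop :=
  [/\ measurable_fun (Theta `*` Theta)
        (fun z : measurableTypeR R * measurableTypeR R => g z.1 z.2),
      forall l t, Theta l -> Theta t -> 0 <= g l t &
      forall l, Theta l -> (\int[mu]_(t in Theta) (g l t)%:E = 1)%E].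

Definition kernel_of_density (g : R -> R -> R) (l : R) (L : set R) : \bar R :=
  (\int[mu]_(t in L) (g l t)%:E)%E.

(* The Markov property with respect to the natural filtration, tested on the
   cylinders {X_0 \in S_0, ..., X_k \in S_k} that generate it. *)
Definition markov_chain d (W : measurableType d) (Pr : probability W R)
    (nu0 : R -> R) (g : R -> R -> R)
    (X : nat -> {RV Pr >-> measurableTypeR R}) : Prop :=
  [/\ forall k w, Theta (X k w),
      forall L : set (measurableTypeR R), measurable L -> L `<=` Theta ->
        Pr (X 0%N @^-1` L) = (\int[mu]_(t in L) (nu0 t)%:E)%E &
      forall k (S : nat -> set (measurableTypeR R))
          (L : set (measurableTypeR R)),
        (forall j, measurable (S j)) -> measurable L -> L `<=` Theta ->
        let E := \bigcap_(j in `I_k.+1) (X j @^-1` S j) in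
        Pr (E `&` X k.+1 @^-1` L) =
        (\int[Pr]_(w in E) kernel_of_density g (X k w) L)%E].

Definition calE n (g : R -> R -> R) (P : R -> 'M[R]_n) (l : R) : 'M[R]_n :=
  \matrix_(i, j) \int[mu]_(t in Theta) (g l t * P t i j).

(* invmx is a genuine inverse here: if P is uniformly positive and g is a
   transition density, calE g P l is positive definite for every l in Theta. *)
Definition Xi n r (gamma : R) (g : R -> R -> R) (A : R -> 'M[R]_n)
    (B : R -> 'M[R]_(n, r)) (C : R -> 'M[R]_(r, n)) (P : R -> 'M[R]_n)
    (l : R) : 'M[R]_(n + (r + (n + r))) :=
  col_mx (row_mx (invmx (calE g P l)) (row_mx 0 (row_mx (A l) (B l))))
 (col_mx (row_mx 0 (row_mx 1%:M (row_mx (C l) 0)))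
 (col_mx (row_mx (A l)^T (row_mx (C l)^T (row_mx (P l) 0)))
         (row_mx (B l)^T (row_mx 0 (row_mx 0 gamma%:M))))).

End Coefficients.

Section Grid.
Context {R : realType}.

Definition is_grid (a b : R) (N : nat) (h : nat -> R) : Prop :=
  [/\ h 0%N = a, h N = b & forall i, (i < N)%N -> h i < h i.+1].

(* Cells are indexed from 0; only the last one is closed on the right. *)
Definition cell (N : nat) (h : nat -> R) (i : 'I_N) : set R :=
  if i.+1 == N then [set` `[h i, h i.+1]] else [set` `[h i, h i.+1[].

Definition cell_prob (mu : {measure set (measurableTypeR R) -> \bar R})
    (g : R -> R -> R) N (h : nat -> R) (i : 'I_N) (l : R) : R :=
  \int[mu]_(t in cell h i) g l t.

(* The width \sum_(i < N) n is n * N. *)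
Definition Qmat (mu : {measure set (measurableTypeR R) -> \bar R})
    (g : R -> R -> R) n N (h : nat -> R) (l : R) :
    'M[R]_(n, \sum_(i < N) n) :=
  \mxrow_(i < N) (Num.sqrt (cell_prob mu g h i l))%:M.

End Grid.

Section LMI.
Context {R : realType}.

Definition Upsilon n N (P : 'I_N -> 'M[R]_n) : 'M[R]_(\sum_(i < N) n) :=
  \mxdiag_(i < N) P i.

(* Each sym_border lists one block row, from its diagonal block to the fourteenth. *)
Local Notation "U :|| V" := (row_mx U V)
  (at level 60, right associativity) : ring_scope.

Definition Pi1 n r s (gamma sA sB sC sQ : R)
    (A : 'M[R]_n) (B : 'M[R]_(n, r)) (C : 'M[R]_(r, n)) (Q : 'M[R]_(n, s))
    (X P : 'M[R]_n) (Ups : 'M[R]_s) (al be rho : R) :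
    'M[R]_(n + (r + (n + (r + (s + (r + (n + (n + (n + (r + (r + (s + (n + r)
          )))))))))))) :=
  sym_border (X + X^T)
    (0 :|| (X *m A) :|| (X *m B) :|| (Q *m Ups) :|| 0 :|| ((2 * sA) *: X) :||
     0 :|| (sB *: X) :|| 0 :|| 0 :|| 0 :|| rho%:M :|| 0)
  (sym_border 1%:M
    (C :|| 0 :|| 0 :|| (2 * sC)%:M :|| 0 :|| 0 :|| 0 :|| 0 :|| 0 :|| 0 :|| 0 :||
     rho%:M)
  (sym_border P
    (0 :|| 0 :|| 0 :|| 0 :|| al%:M :|| 0 :|| 0 :|| 0 :|| 0 :|| 0 :|| 0)
  (sym_border gamma%:M
    (0 :|| 0 :|| 0 :|| 0 :|| 0 :|| 0 :|| be%:M :|| 0 :|| 0 :|| 0)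
  (sym_border Ups
    (0 :|| 0 :|| 0 :|| 0 :|| 0 :|| 0 :|| (sQ *: Ups) :|| 0 :|| 0)
  (sym_border (2 * al)%:M (0 :|| 0 :|| 0 :|| 0 :|| 0 :|| 0 :|| 0 :|| 0)
  (sym_border (2 * al)%:M (0 :|| 0 :|| 0 :|| 0 :|| 0 :|| 0 :|| 0)
  (sym_border al%:M (0 :|| 0 :|| 0 :|| 0 :|| 0 :|| 0)
  (sym_border be%:M (0 :|| 0 :|| 0 :|| 0 :|| 0)
  (sym_border be%:M (0 :|| 0 :|| 0 :|| 0)
  (sym_border be%:M (0 :|| 0 :|| 0)
  (sym_border rho%:M (0 :|| 0)
  (sym_border rho%:M 0
  rho%:M)))))))))))).

Definition LMI_feasible n r N (gamma : R) (sA sB sC sQ : 'I_N -> R)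
    (A : 'I_N -> 'M[R]_n) (B : 'I_N -> 'M[R]_(n, r))
    (C : 'I_N -> 'M[R]_(r, n)) (Q : 'I_N -> 'M[R]_(n, \sum_(i < N) n)) : Prop :=
  exists (X P : 'I_N -> 'M[R]_n) (al be rho : 'I_N -> R),
  forall i,
    [/\ X i \in unitmx, pos_def (P i),
        [/\ 0 < al i, 0 < be i & 0 < rho i] &
        pos_def (Pi1 gamma (sA i) (sB i) (sC i) (sQ i) (A i) (B i) (C i) (Q i)
                   (X i) (P i) (Upsilon P) (al i) (be i) (rho i))].

End LMI.

(* Main.v *)
(** With a piecewise constant [P = P_k] on the k-th cell, [calE P l] equals
    [Q(l) Upsilon Q(l)^T]. Put [x = X^T u] in the quadratic form of [Xi].
    Completing squares, [x^T E^-1 x >= u^T (X + X^T - E) u], and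
    [- u^T E u = v^T Upsilon v + 2 u^T Q Upsilon v] at [v = - Q^T u], so it is
    enough to bound below the form of the first five block rows of [Pi1], with the
    coefficients at [l] instead of those at the grid point. The remaining nine
    components of the argument of [Pi1] can be chosen so that [Pi1] evaluates
    to at most the unperturbed form minus the terms that Young's inequality loses
    on the perturbations. *)
Require Import Defs.
From mathcomp Require Import all_boot all_order all_algebra.
From mathcomp Require Import all_classical all_reals all_analysis.
From mathcomp Require Import measurable_realfun ess_sup_inf.
From mathcomp Require Import ring lra.
Set Implicit Arguments.
Unset Strict Implicit.
Unset Printing Implicit Defensive.
Import Order.TTheory GRing.Theory Num.Theory.
Import numFieldNormedType.Exports.
Local Open Scope classical_set_scope.
Local Open Scope ring_scope.

(** * Inner products, positive definite forms and norm bounds *)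

Section DotProduct.
Context {R : realType}.

Definition dotp n (x y : 'cV[R]_n) : R := (x^T *m y) 0 0.

Lemma dotpE n (x y : 'cV[R]_n) : dotp x y = \sum_i x i 0 * y i 0.
Proof. by rewrite /dotp mxE; apply: eq_bigr => i _; rewrite mxE. Qed.

Lemma dotpC n (x y : 'cV[R]_n) : dotp x y = dotp y x.
Proof. by rewrite !dotpE; apply: eq_bigr => i _; rewrite mulrC. Qed.

Lemma dotpDr n (x y z : 'cV[R]_n) : dotp x (y + z) = dotp x y + dotp x z.
Proof. by rewrite /dotp mulmxDr mxE. Qed.

Lemma dotpDl n (x y z : 'cV[R]_n) : dotp (x + y) z = dotp x z + dotp y z.
Proof. by rewrite dotpC dotpDr !(dotpC z). Qed.

Lemma dotpZr n c (x y : 'cV[R]_n) : dotp x (c *: y) = c * dotp x y.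
Proof. by rewrite /dotp -scalemxAr mxE. Qed.

Lemma dotpZl n c (x y : 'cV[R]_n) : dotp (c *: x) y = c * dotp x y.
Proof. by rewrite dotpC dotpZr dotpC. Qed.

Lemma dotpNr n (x y : 'cV[R]_n) : dotp x (- y) = - dotp x y.
Proof. by rewrite -scaleN1r dotpZr mulN1r. Qed.

Lemma dotpNl n (x y : 'cV[R]_n) : dotp (- x) y = - dotp x y.
Proof. by rewrite dotpC dotpNr dotpC. Qed.

Lemma dotp0r n (x : 'cV[R]_n) : dotp x 0 = 0.
Proof. by rewrite /dotp mulmx0 mxE. Qed.

Lemma dotp0l n (x : 'cV[R]_n) : dotp 0 x = 0.
Proof. by rewrite dotpC dotp0r. Qed.

Lemma dotp_mull m n (M : 'M[R]_(m, n)) x y : dotp (M *m x) y = dotp x (M^T *m y).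
Proof. by rewrite /dotp trmx_mul mulmxA. Qed.

Lemma dotp_ge0 n (x : 'cV[R]_n) : 0 <= dotp x x.
Proof. by rewrite dotpE sumr_ge0// => i _; rewrite -expr2 sqr_ge0. Qed.

Lemma dotp_gt0 n (x : 'cV[R]_n) : x != 0 -> 0 < dotp x x.
Proof.
move=> x0; rewrite lt_def dotp_ge0 andbT; apply: contraNneq x0.
rewrite dotpE => /psumr_eq0P x0; apply/eqP/matrixP => i j.
rewrite ord1 mxE; apply/eqP; rewrite -sqrf_eq0 expr2.
by apply/eqP/x0 => // k _; rewrite -expr2 sqr_ge0.
Qed.

Lemma dotp_col m n (x1 y1 : 'cV[R]_m) (x2 y2 : 'cV[R]_n) :
  dotp (col_mx x1 x2) (col_mx y1 y2) = dotp x1 y1 + dotp x2 y2.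
Proof. by rewrite /dotp tr_col_mx mul_row_col mxE. Qed.

Lemma eucl_normE n (x : 'cV[R]_n) : eucl_norm x = Num.sqrt (dotp x x).
Proof.
by rewrite /eucl_norm dotpE; congr Num.sqrt; apply: eq_bigr => i _; rewrite expr2.
Qed.

(** Expand the nonnegative square of [t *: x + y] and divide by [t]. *)
Lemma dotp_young n (x y : 'cV[R]_n) (t : R) : 0 < t ->
  - (t * dotp x x + t^-1 * dotp y y) <= 2 * dotp x y.
Proof.
move=> t0; have := dotp_ge0 (t *: x + y).
rewrite dotpDl !dotpDr !dotpZl !dotpZr (dotpC y) => h.
have : 0 <= t^-1 * (t * (t * dotp x x) + t * dotp x y + (t * dotp x y + dotp y y)).
  by rewrite mulr_ge0// invr_ge0 ltW.
rewrite !mulrDr !mulKf ?gt_eqF//; lra.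
Qed.

Lemma quad_formE n (M : 'M[R]_n) x : quad_form M x = dotp x (M *m x).
Proof. by rewrite /quad_form /dotp mulmxA. Qed.

Lemma quad_form_scalar n (c : R) (x : 'cV[R]_n) :
  quad_form c%:M x = c * dotp x x.
Proof. by rewrite quad_formE mul_scalar_mx dotpZr. Qed.

Lemma quad_formB_scalar n (M : 'M[R]_n) c x :
  quad_form (M - c%:M) x = quad_form M x - c * dotp x x.
Proof. by rewrite !quad_formE mulmxBl mul_scalar_mx dotpDr dotpNr dotpZr. Qed.

(** Serves to peel off the nested block rows of [Pi1] one at a time. *)
Lemma quad_form_border m n (D : 'M[R]_m) (U : 'M[R]_(m, n)) (S : 'M[R]_n) x y :
  quad_form (sym_border D U S) (col_mx x y) =
  quad_form D x + 2 * dotp x (U *m y) + quad_form S y.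
Proof.
rewrite !quad_formE mul_block_col dotp_col !dotpDr.
rewrite (dotpC y (_ *m x)) dotp_mull trmxK; ring.
Qed.

(** Cauchy-Schwarz for a semidefinite form. Evaluating at [q(y) x - b y], with [q] the form, gives
    [q(y) (q(x) q(y) - b^2) >= 0], which settles the case [q(y) > 0]. *)
Lemma quad_form_discr n (M : 'M[R]_n) : M^T = M -> (forall x, 0 <= quad_form M x) ->
  forall x y, dotp x (M *m y) ^+ 2 <= quad_form M x * quad_form M y.
Proof.
move=> Msym M0 x y; set b := dotp _ _.
have sq t s : quad_form M (t *: x + s *: y) =
    t ^+ 2 * quad_form M x + 2 * (t * s) * b + s ^+ 2 * quad_form M y.
  rewrite !quad_formE mulmxDr dotpDl !dotpDr -!scalemxAr !dotpZl !dotpZr.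
  rewrite (dotpC y (M *m x)) dotp_mull Msym -/b; ring.
have := M0 (quad_form M y *: x + (- b) *: y); rewrite sq => h.
have := M0 y; rewrite le_eqVlt => /orP[/eqP My0|My0]; last first.
  have {}h : 0 <= quad_form M y * (quad_form M x * quad_form M y - b ^+ 2).
    by apply: le_trans h _; rewrite le_eqVlt; apply/orP; left; apply/eqP; ring.
  by move: h; rewrite pmulr_rge0// subr_ge0.
rewrite -My0 mulr0 real_leNgt ?num_real//; apply/negP => b0.
(* When [q(y) = 0] the form at this vector is [- b^2 (q(x) + 2)], so a nonzero [b] would make it
   negative. *)
have := M0 (b *: x + (- (quad_form M x + 1)) *: y); rewrite sq -My0.
have := M0 x; move: (quad_form M x) b0 => q b0 q0; nra.
Qed.

(** By symmetry a row of the left kernel is, transposed, a vector killed by [M]; its form vanishes,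
    so the vector does too. *)
Lemma pos_def_unit n (M : 'M[R]_n) : pos_def M -> M \in unitmx.
Proof.
move=> [Msym Mpos]; rewrite -row_free_unit -kermx_eq0.
apply/eqP/row_matrixP => i; rewrite row0; set v := row i _.
have vM : v *m M = 0 by rewrite /v -row_mul mulmx_ker row0.
apply/eqP/contraT => v0; have := Mpos v^T.
by rewrite trmx_eq0 quad_formE -{1}Msym -trmx_mul vM trmx0 dotp0r ltxx => /(_ v0).
Qed.

(* Cauchy-Schwarz for the inner product of M gives
   x_k^2 = (M^-1 e_k, x)_M^2 <= (e_k^T M^-1 e_k) (x^T M x); sum over k. *)
Lemma pos_def_coercive n (M : 'M[R]_n) : pos_def M ->
  exists2 c, 0 < c & forall x, c * dotp x x <= quad_form M x.
Proof.
move=> Mpos; have Mu := pos_def_unit Mpos; case: Mpos => Msym Mpos.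
have M0 x : 0 <= quad_form M x.
  by have [->|/Mpos/ltW//] := eqVneq x 0; rewrite quad_formE mulmx0 dotp0r.
pose e k : 'cV[R]_n := invmx M *m delta_mx k 0.
have xk (x : 'cV[R]_n) k : dotp (e k) (M *m x) = x k 0.
  rewrite dotpC dotp_mull Msym /e mulKVmx// dotpE (bigD1 k)//= big1 ?addr0.
    by rewrite mxE !eqxx mulr1.
  by move=> i ik; rewrite mxE (negPf ik) mulr0.
pose s := \sum_k quad_form M (e k).
have s0 : 0 <= s by exact: sumr_ge0.
(* Adding 1 keeps the denominator positive even for [n = 0], where [s = 0]. *)
exists (s + 1)^-1; first by rewrite invr_gt0; lra.
move=> x; rewrite mulrC ler_pdivrMr; last by lra.
have : dotp x x <= s * quad_form M x.
  rewrite dotpE /s mulr_suml; apply: ler_sum => k _.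
  by rewrite -expr2 -(xk x k); apply: quad_form_discr.
have := M0 x; rewrite mulrDr mulr1 mulrC; lra.
Qed.

(** The squared Frobenius norm, an explicit bound for the squared operator norm. *)
Definition frob2 m n (M : 'M[R]_(m, n)) : R := \sum_i dotp (row i M)^T (row i M)^T.

Lemma frob2_ge0 m n (M : 'M[R]_(m, n)) : 0 <= frob2 M.
Proof. by apply: sumr_ge0 => i _; exact: dotp_ge0. Qed.

(** Cauchy-Schwarz on each row, obtained from [quad_form_discr] at the identity matrix. *)
Lemma dotp_mulmx_frob2 m n (M : 'M[R]_(m, n)) x :
  dotp (M *m x) (M *m x) <= frob2 M * dotp x x.
Proof.
rewrite dotpE /frob2 mulr_suml; apply: ler_sum => i _.
have -> : (M *m x) i 0 = dotp (row i M)^T (1%:M *m x).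
  by rewrite mul1mx mxE dotpE; apply: eq_bigr => j _; rewrite !mxE.
have := @quad_form_discr n 1%:M; rewrite trmx1 => /(_ erefl).
have q1 (y : 'cV[R]_n) : quad_form 1%:M y = dotp y y by rewrite quad_form_scalar mul1r.
have q0 (y : 'cV[R]_n) : 0 <= quad_form 1%:M y by rewrite q1 dotp_ge0.
by move=> /(_ q0 (row i M)^T x); rewrite !q1 -expr2.
Qed.

(** Normalising [x] makes it admissible in the supremum. A [sup] dominates its set only when the set
    is bounded above, which the Frobenius bound provides. *)
Lemma spectral_norm_mulmx m n (M : 'M[R]_(m, n)) s x : spectral_norm M <= s ->
  dotp (M *m x) (M *m x) <= s ^+ 2 * dotp x x.
Proof.
move=> Ms; have [->|x0] := eqVneq x 0; first by rewrite mulmx0 !dotp0r mulr0.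
have d0 := dotp_gt0 x0; set t := Num.sqrt (dotp x x).
have t0 : 0 < t by rewrite sqrtr_gt0.
have tt : t ^+ 2 = dotp x x by rewrite sqr_sqrtr// ltW.
have /= le_s : eucl_norm (M *m (t^-1 *: x)) <= s.
  apply: le_trans Ms; apply: ub_le_sup; last first.
    exists (t^-1 *: x) => //=; rewrite eucl_normE dotpZl dotpZr -tt.
    by rewrite expr2 mulKf ?mulVf ?gt_eqF// sqrtr1.
  exists (Num.sqrt (frob2 M)) => _ [y /= y1 <-]; rewrite eucl_normE.
  apply: ler_wsqrtr; apply: le_trans (dotp_mulmx_frob2 _ _) _.
  rewrite ler_piMr ?frob2_ge0//; move: y1; rewrite eucl_normE.
  by rewrite -{1}sqrtr1 ler_psqrt// ?nnegrE ?dotp_ge0.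
move: le_s; rewrite eucl_normE -scalemxAr dotpZl dotpZr.
set q := dotp _ _ => le_s.
have q0 : 0 <= q by exact: dotp_ge0.
have u0 : 0 <= t^-1 * (t^-1 * q) by rewrite !mulr_ge0// invr_ge0 ltW.
have : t^-1 * (t^-1 * q) <= s ^+ 2.
  rewrite -(sqr_sqrtr u0) ler_sqr ?nnegrE ?sqrtr_ge0//.
  exact: le_trans (sqrtr_ge0 _) le_s.
by rewrite mulrA -invfM -expr2 tt mulrC ler_pdivrMr.
Qed.

End DotProduct.

(** * Absorbing the perturbations of the coefficients in [Pi1] *)

Section PerturbedLMI.
Context {R : realType}.

Lemma dotp_perturb m n (D : 'M[R]_(m, n)) sigma t x y : 0 < t ->
  (forall v, dotp (D *m v) (D *m v) <= sigma ^+ 2 * dotp v v) ->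
  - (t * dotp x x + sigma ^+ 2 / t * dotp y y) <= 2 * dotp x (D *m y).
Proof.
move=> t0 /(_ y) D_le; apply: le_trans (dotp_young x (D *m y) t0).
by rewrite lerN2 lerD2l [_ / t]mulrC -mulrA ler_pM2l ?invr_gt0.
Qed.

Lemma dotp_row m n1 n2 x (U : 'M[R]_(m, n1)) (V : 'M[R]_(m, n2)) y z :
  dotp x (row_mx U V *m col_mx y z) = dotp x (U *m y) + dotp x (V *m z).
Proof. by rewrite mul_row_col dotpDr. Qed.

Lemma dotp_row0 m n1 n2 x (V : 'M[R]_(m, n2)) (y : 'cV[R]_n1) z :
  dotp x (row_mx 0 V *m col_mx y z) = dotp x (V *m z).
Proof. by rewrite dotp_row mul0mx dotp0r add0r. Qed.

Lemma dotp_0mx m n x (y : 'cV[R]_n) : dotp x ((0 : 'M[R]_(m, n)) *m y) = 0.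
Proof. by rewrite mul0mx dotp0r. Qed.

(** The last nine block components are coupled only to the first five, so the form of [Pi1] can be
    minimised over each of them separately. The minimum is the unperturbed form minus squares that
    cover the Young losses of [dA], [dB], [dC] and [dQ]. *)
Lemma Pi1_perturbed n r s (gamma sA sB sC sQ c : R)
    (A dA : 'M[R]_n) (B dB : 'M[R]_(n, r)) (C dC : 'M[R]_(r, n))
    (Q dQ : 'M[R]_(n, s)) (X P : 'M[R]_n) (Ups : 'M[R]_s) (al be rho : R) :
  0 < sA -> 0 < sB -> 0 < sC ->
  0 < al -> 0 < be -> 0 < rho -> 0 <= c -> Ups^T = Ups ->
  (forall v, dotp (dA *m v) (dA *m v) <= sA ^+ 2 * dotp v v) ->
  (forall v, dotp (dB *m v) (dB *m v) <= sB ^+ 2 * dotp v v) ->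
  (forall v, dotp (dC *m v) (dC *m v) <= sC ^+ 2 * dotp v v) ->
  (forall v, dotp (dQ *m v) (dQ *m v) <= sQ ^+ 2 * dotp v v) ->
  (forall v, c * dotp v v <=
     quad_form (Pi1 gamma sA sB sC sQ A B C Q X P Ups al be rho) v) ->
  forall u y z w v,
  c * (dotp u u + dotp y y + dotp z z + dotp w w) <=
  2 * dotp u (X *m u) + dotp y y + quad_form P z + gamma * dotp w w +
  quad_form Ups v + 2 * dotp (X^T *m u) ((A + dA) *m z) +
  2 * dotp (X^T *m u) ((B + dB) *m w) + 2 * dotp u ((Q + dQ) *m (Ups *m v)) +
  2 * dotp y ((C + dC) *m z).
Proof.
move=> sA0 sB0 sC0 al0 be0 rho0 c0 UpsT hA hB hC hQ hPi u y z w v.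
have dX m (M : 'M[R]_(n, m)) t : dotp u (X *m (M *m t)) = dotp (X^T *m u) (M *m t).
  by rewrite dotp_mull trmxK.
have dX1 t : dotp u (X *m t) = dotp (X^T *m u) t by rewrite dotp_mull trmxK.
have dUps (t : 'cV[R]_s) : dotp v (Ups *m t) = dotp (Ups *m v) t.
  by rewrite dotp_mull UpsT.
have qX : quad_form (X + X^T) u = 2 * dotp u (X^T *m u).
  by rewrite !quad_formE mulmxDl dotpDr dX1 dotpC -mulr2n mulr_natl.
have -> : dotp u (X *m u) = dotp u (X^T *m u) by rewrite dX1 dotpC.
(* Writing each bound as a multiple of its multiplier removes all divisions, so that the final
   comparison is linear in common monomials. *)
have [[kA eA] [kB eB] [kC eC] [kQ eQ]] :
    [/\ exists k, sA = k * al, exists k, sB = k * be, exists k, sC = k * al &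
        exists k, sQ = k * rho].
  by split; [exists (sA / al)|exists (sB / be)|exists (sC / al)|exists (sQ / rho)];
     rewrite divfK// gt_eqF.
set x := X^T *m u in dX dX1 qX *; set p := Ups *m v in dUps *.
have kA0 : 0 < kA by rewrite eA pmulr_lgt0 in sA0.
have kB0 : 0 < kB by rewrite eB pmulr_lgt0 in sB0.
have kC0 : 0 < kC by rewrite eC pmulr_lgt0 in sC0.
(* The Young weights are those for which the losses match the minimised form. The eighth component
   yields [al * dotp z z], shared equally between [dC] and [dA]. *)
have YC : - (2 * kC ^+ 2 * al * dotp y y + al / 2 * dotp z z) <=
    2 * dotp y (dC *m z).
  have -> : al / 2 = sC ^+ 2 / (2 * kC ^+ 2 * al).
    by rewrite eC; field; rewrite !gt_eqF.
  by apply: dotp_perturb => //; rewrite !mulr_gt0// exprn_gt0.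
have YA : - (2 * kA ^+ 2 * al * dotp x x + al / 2 * dotp z z) <=
    2 * dotp x (dA *m z).
  have -> : al / 2 = sA ^+ 2 / (2 * kA ^+ 2 * al).
    by rewrite eA; field; rewrite !gt_eqF.
  by apply: dotp_perturb => //; rewrite !mulr_gt0// exprn_gt0.
have YB : - (kB ^+ 2 * be * dotp x x + be * dotp w w) <= 2 * dotp x (dB *m w).
  have {2}-> : be = sB ^+ 2 / (kB ^+ 2 * be).
    by rewrite eB; field; rewrite !gt_eqF.
  by apply: dotp_perturb => //; rewrite mulr_gt0// exprn_gt0.
have YQ : - (rho * dotp u u + kQ ^+ 2 * rho * dotp p p) <= 2 * dotp u (dQ *m p).
  have -> : kQ ^+ 2 * rho = sQ ^+ 2 / rho by rewrite eQ; field; rewrite gt_eqF.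
  exact: dotp_perturb.
(* The minimisers of the last nine components; the tenth is 0 because its block is coupled to
   nothing. *)
pose e6 := - kC *: y; pose e7 := - kA *: x; pose e9 := - kB *: x.
pose e12 := - kQ *: p.
have := hPi (col_mx u (col_mx y (col_mx z (col_mx w (col_mx v (col_mx e6 (col_mx e7
  (col_mx (- z) (col_mx e9 (col_mx 0 (col_mx (- w) (col_mx e12
  (col_mx (- u) (- y)))))))))))))).
rewrite /Pi1 !quad_form_border !quad_form_scalar.
rewrite ?(dotp_row0, dotp_row, dotp_0mx) !dotp_col.
(* On the coercive side only the squares of the components [u], [y], [z], [w] are kept; these are
   the remaining ones. *)
have : 0 <= c * (dotp v v + dotp e6 e6 + dotp e7 e7 + dotp z z + dotp e9 e9 +
    dotp w w + dotp e12 e12 + dotp u u + dotp y y).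
  by rewrite mulr_ge0// !addr_ge0// dotp_ge0.
(* The fourteenth component lowers the form by this further amount, which is simply dropped. *)
have : 0 <= rho * dotp y y by rewrite mulr_ge0 ?dotp_ge0 ?ltW.
rewrite qX !mul_scalar_mx -!scalemxAl /e6 /e7 /e9 /e12 -!scalemxAr.
rewrite -!mulmxA !(mulmxDl, dotpDr).
rewrite ?(dotpZr, dotpNr, dotpZl, dotpNl, dotp0r, dotp0l).
rewrite !dX ?dX1 !dUps -/p -/x eA eB eC eQ.
move: YA YB YC YQ; clear.
move: (dotp u u) (dotp y y) (dotp z z) (dotp w w) (dotp v v) (dotp p p)
  (dotp x x) (dotp u x) (quad_form P z) (quad_form Ups v) (dotp x (A *m z))
  (dotp x (dA *m z)) (dotp x (B *m w)) (dotp x (dB *m w)) (dotp u (Q *m p))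
  (dotp u (dQ *m p)) (dotp y (C *m z)) (dotp y (dC *m z)).
clear; move=> *; lra.
Qed.

End PerturbedLMI.

(** * Lower bound for the form of [Xi] at one point *)

Section PointwiseBound.
Context {R : realType}.

(** Completion of the square: expand the form of [E] at [invmx E *m x - u]. *)
Lemma quad_form_invmx_ge n (E : 'M[R]_n) x u : pos_def E ->
  2 * dotp x u - quad_form E u <= quad_form (invmx E) x.
Proof.
move=> Epos; have Eu := pos_def_unit Epos; case: Epos => ET Epos.
have : 0 <= quad_form E (invmx E *m x - u).
  have [->|/Epos/ltW//] := eqVneq (invmx E *m x - u) 0.
  by rewrite quad_formE mulmx0 dotp0r.
rewrite !quad_formE mulmxBr mulKVmx// dotpDl !dotpDr !dotpNl !dotpNr.
rewrite [dotp (invmx E *m x) (E *m u)]dotp_mull trmx_inv ET mulKmx//.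
by rewrite (dotpC u x) (dotpC (_ *m x)); lra.
Qed.

Lemma Xi_form_bound n r s (gamma sA sB sC sQ c : R)
    (A A' : 'M[R]_n) (B B' : 'M[R]_(n, r)) (C C' : 'M[R]_(r, n))
    (Q Q' : 'M[R]_(n, s)) (X P E : 'M[R]_n) (Ups : 'M[R]_s) (al be rho : R) :
  0 < sA -> 0 < sB -> 0 < sC ->
  0 < al -> 0 < be -> 0 < rho -> 0 <= c -> Ups^T = Ups -> X \in unitmx ->
  spectral_norm (A' - A) <= sA -> spectral_norm (B' - B) <= sB ->
  spectral_norm (C' - C) <= sC -> spectral_norm (Q' - Q) <= sQ ->
  (forall v, c * dotp v v <=
     quad_form (Pi1 gamma sA sB sC sQ A B C Q X P Ups al be rho) v) ->
  pos_def E -> E = Q' *m Ups *m Q'^T ->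
  forall x y z w,
  c / (1 + frob2 X^T) * (dotp x x + dotp y y + dotp z z + dotp w w) <=
  quad_form (invmx E) x + dotp y y + quad_form P z + gamma * dotp w w +
  2 * dotp x (A' *m z) + 2 * dotp x (B' *m w) + 2 * dotp y (C' *m z).
Proof.
move=> sA0 sB0 sC0 al0 be0 rho0 c0 UpsT Xu hA hB hC hQ hPi Epos EE x y z w.
pose u := invmx X^T *m x; pose v := - (Q'^T *m u).
have xu : X^T *m u = x by rewrite mulKVmx// unitmx_tr.
have := Pi1_perturbed sA0 sB0 sC0 al0 be0 rho0 c0 UpsT
  (fun t => spectral_norm_mulmx t hA) (fun t => spectral_norm_mulmx t hB)
  (fun t => spectral_norm_mulmx t hC) (fun t => spectral_norm_mulmx t hQ)
  hPi u y z w v.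
rewrite ![_ + (_ - _)]addrC !subrK xu.
have -> : dotp u (X *m u) = dotp x u by rewrite -xu dotp_mull trmxK.
have -> : dotp u (Q' *m (Ups *m v)) = - quad_form E u.
  by rewrite quad_formE EE /v !mulmxN dotpNr !mulmxA.
have -> : quad_form Ups v = quad_form E u.
  rewrite !quad_formE EE /v !mulmxN dotpNl dotpNr opprK dotp_mull trmxK.
  by rewrite !mulmxA.
have := quad_form_invmx_ge x u Epos.
(* Since [x = X^T u], the square of [x] is at most [frob2 X^T] times that of [u]. The added 1 keeps
   the quotient at most [c], as [y], [z] and [w] require. *)
have : c / (1 + frob2 X^T) * (dotp x x + dotp y y + dotp z z + dotp w w) <=
    c * (dotp u u + dotp y y + dotp z z + dotp w w).
  rewrite -mulrA ler_wpM2l// mulrC ler_pdivrMr; last by rewrite ltr_pwDl// frob2_ge0.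
  have := dotp_mulmx_frob2 X^T u; rewrite xu.
  have := dotp_ge0 u; have := dotp_ge0 y; have := dotp_ge0 z; have := dotp_ge0 w.
  have := frob2_ge0 X^T; move: (frob2 _) => f f0 w0 z0 y0 u0; nra.
lra.
Qed.

Lemma quad_form_Xi (Theta : set R) (mu : {measure set (measurableTypeR R) -> \bar R})
    n r gamma g (A : R -> 'M[R]_n) (B : R -> 'M[R]_(n, r)) C P l x y z w :
  quad_form (Xi Theta mu gamma g A B C P l) (col_mx x (col_mx y (col_mx z w))) =
  quad_form (invmx (calE Theta mu g P l)) x + dotp y y + quad_form (P l) z +
  gamma * dotp w w + 2 * dotp x (A l *m z) + 2 * dotp x (B l *m w) +
  2 * dotp y (C l *m z).
Proof.
rewrite !quad_formE /Xi !mul_col_mx !mul_row_col !mul0mx !mul1mx !mul_scalar_mx.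
rewrite !dotp_col !dotpDr !dotpZr !dotp0r (dotpC z (_^T *m x)) (dotpC w (_^T *m x)).
rewrite (dotpC z (_^T *m y)) !dotp_mull !trmxK; ring.
Qed.

Lemma Xi_sym (Theta : set R) (mu : {measure set (measurableTypeR R) -> \bar R})
    n r gamma g (A : R -> 'M[R]_n) (B : R -> 'M[R]_(n, r)) C P l :
  (calE Theta mu g P l)^T = calE Theta mu g P l -> (P l)^T = P l ->
  (Xi Theta mu gamma g A B C P l)^T = Xi Theta mu gamma g A B C P l.
Proof.
move=> ET PT; rewrite /Xi !tr_col_mx !tr_row_mx !trmx0 !trmxK trmx_inv ET PT.
rewrite !tr_scalar_mx.
(* Transposing gives a row of columns while [Xi] is a column of rows; this interchange law brings
   both to one shape. *)
have col_row m1 m2 n1 n2 (a : 'M[R]_(m1, n1)) b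
    (c : 'M[R]_(m2, n1)) (d : 'M[R]_(m2, n2)) :
    col_mx (row_mx a b) (row_mx c d) = row_mx (col_mx a c) (col_mx b d).
  by rewrite -block_mxEv block_mxEh.
by rewrite !col_row.
Qed.

End PointwiseBound.

(** * The partition into cells and step functions on it *)

Section Grid.
Context {R : realType} (a b : R) (N : nat) (h : nat -> R).
Hypothesis hgrid : is_grid a b N h.

Lemma grid_mono i j : (i <= j <= N)%N -> h i <= h j.
Proof.
case: hgrid => _ _ hS /andP[ij jN].
elim: j ij jN => [|j IH]; first by rewrite leqn0 => /eqP->.
rewrite leq_eqVlt => /orP[/eqP-> //|ij jN].
by apply: le_trans (IH _ _) (ltW (hS _ _)); rewrite // ltnW.
Qed.

Lemma measurable_cell (i : 'I_N) : measurable (cell h i : set (measurableTypeR R)).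
Proof. by rewrite /cell; case: ifP => _; exact: measurable_itv. Qed.

Lemma trivIset_cell : trivIset setT (@cell R N h).
Proof.
have lt_disj (i j : 'I_N) x : (i < j)%N -> cell h i x -> cell h j x -> False.
  (* As [i < j], cell [i] is not the last one, hence open on the right: [x < h i.+1 <= h j <= x] is
     the contradiction. *)
  move=> ij; rewrite /cell ltn_eqF; last exact: leq_ltn_trans ij (ltn_ord j).
  rewrite /= in_itv/= => /andP[_ xi] xj.
  have hj : h j <= x by move: xj; case: ifP => _; rewrite /= in_itv/= => /andP[].
  have := grid_mono (i := i.+1) (j := j); rewrite ij ltnW// => /(_ isT) hij.
  by have := lt_le_trans xi (le_trans hij hj); rewrite ltxx.
apply/trivIsetP => i j _ _ ij; rewrite -subset0 => x [xi xj].
by move: ij; rewrite neq_ltn => /orP[] lt; [apply: lt_disj xi xj|apply: lt_disj xj xi].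
Qed.

Lemma cell_subset (i : 'I_N) : cell h i `<=` `[a, b].
Proof.
case: (hgrid) => h0 hN _ x xi.
have /andP[hx xh] : h i <= x <= h i.+1.
  move: xi; rewrite /cell; case: ifP => _; rewrite /= in_itv/= => /andP[-> /=] //.
  exact: ltW.
rewrite /= in_itv/= -h0 -hN; apply/andP; split.
  by apply: le_trans hx; rewrite grid_mono//= ltnW.
by apply: le_trans xh _; rewrite grid_mono// leqnn ltn_ord.
Qed.

Lemma cell_cover x : a < b -> a <= x <= b -> exists i : 'I_N, cell h i x.
Proof.
case: (hgrid) => h0 hN _ ab /andP[ax xb].
have [m [mN hmx xhm]] : exists m, [/\ (m < N)%N, h m <= x &
    (x < h m.+1) || (m.+1 == N) && (x <= h m.+1)].
  have N0 : (0 < N)%N.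
    by rewrite lt0n; apply/negP => /eqP N0; move: ab; rewrite -h0 -hN N0 ltxx.
  (* The end point [b] goes to the last cell. For [x < b], the cell ends at the first grid point
     beyond [x]; that point is not [h 0] since [a <= x]. *)
  have [xb'|bx] := ltP x b; last first.
    exists N.-1; rewrite prednK// eqxx hN xb orbT leqnn; split => //.
    by apply: le_trans bx; rewrite -hN grid_mono// leq_pred leqnn.
  have : exists m, x < h m by exists N; rewrite hN.
  case/ex_minnP => -[|m]; first by rewrite h0 ltNge ax.
  move=> xm min; exists m; rewrite xm; split => //.
    by apply: min; rewrite hN.
  by rewrite leNgt; apply/negP => /min; rewrite ltnn.
exists (Ordinal mN); rewrite /cell/=; case: ifP xhm => /= _; rewrite in_itv/= hmx/=.
  by case/orP => // /ltW.
by rewrite orbF.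
Qed.

Lemma bigcup_cell : a < b -> \big[setU/set0]_(i < N) cell h i = `[a, b]%classic.
Proof.
move=> ab; rewrite -bigcup_seq; apply/seteqP; split => [x [i _]|x].
  exact: cell_subset.
by rewrite /= in_itv/= => /(cell_cover ab)[i xi]; exists i; rewrite //= mem_index_enum.
Qed.

(** A sum of indicators makes the entries visibly measurable on the whole line; the value outside
    all cells is 0. *)
Definition step_mx n (Ps : 'I_N -> 'M[R]_n) (l : R) : 'M[R]_n :=
  \sum_k \1_(cell h k) l *: Ps k.

Lemma step_mx_cell n (Ps : 'I_N -> 'M[R]_n) l k : cell h k l -> step_mx Ps l = Ps k.
Proof.
move=> kl; rewrite /step_mx (bigD1 k)//= big1 ?addr0 => [|j jk].
  by rewrite indicE mem_set// scale1r.
rewrite indicE memNset ?scale0r// => jl.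
by move: jk; rewrite (trivIset_cell I I (ex_intro _ l (conj jl kl))) eqxx.
Qed.

Lemma step_mx_sym n (Ps : 'I_N -> 'M[R]_n) l : (forall k, (Ps k)^T = Ps k) ->
  (step_mx Ps l)^T = step_mx Ps l.
Proof.
move=> PT; rewrite /step_mx raddf_sum/=; apply: eq_bigr => k _.
by rewrite linearZ/= PT.
Qed.

Lemma measurable_step_mx n (Ps : 'I_N -> 'M[R]_n) (D : set (measurableTypeR R)) i j :
  measurable_fun D (fun l : measurableTypeR R => step_mx Ps l i j).
Proof.
rewrite (_ : (fun _ => _) = fun l => \sum_k Ps k i j * \1_(cell h k) l); last first.
  apply/funext => l; rewrite /step_mx summxE; apply: eq_bigr => k _.
  by rewrite mxE mulrC.
apply: measurable_sum => k; apply: measurable_funM; first exact: measurable_cst.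
by apply: measurable_indic; exact: measurable_cell.
Qed.

End Grid.

(** * The operator [calE] on step functions *)

Section StepIntegrals.
Context {R : realType} (a b : R) (N : nat) (h : nat -> R).
Context (mu : {measure set (measurableTypeR R) -> \bar R}) (g : R -> R -> R).
Hypotheses (ab : a < b) (hgrid : is_grid a b N h).
Hypothesis hg : transition_density (`[a, b]%classic : set R) mu g.

(** A section of a jointly measurable function is measurable, and nonnegativity makes the integral
    of the absolute value equal to 1. *)
Lemma density_integrable l : `[a, b]%classic l ->
  mu.-integrable `[a, b]%classic (fun t => (g l t)%:E).
Proof.
case: hg => gm g0 g1 lab; apply/integrableP; split.
  apply/measurable_EFinP.
  apply: (measurable_comp (F := `[a, b]%classic `*` `[a, b]%classic)
    (g := pair l) _ _ gm).
  - exact: measurableX.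
  - by move=> _ [t tab <-].
  - exact/measurable_funTS/pair1_measurable.
apply: le_lt_trans (ltry 1); rewrite -(g1 l lab) le_eqVlt; apply/orP; left; apply/eqP.
by apply: eq_integral => t /set_mem tab; rewrite /= ger0_norm// g0.
Qed.

(** Integrability is asked cell by cell because the integrand of [calE] is there a constant multiple
    of the density; it makes every term finite, so that [fine] commutes with the sum. *)
Lemma Rintegral_cells (f : R -> R) : measurable_fun `[a, b]%classic f ->
  (forall k : 'I_N, mu.-integrable (cell h k) (EFin \o f)) ->
  \int[mu]_(t in `[a, b]) f t = \sum_(k < N) \int[mu]_(t in cell h k) f t.
Proof.
move=> fm fi; rewrite /Rintegral -(bigcup_cell hgrid ab) integral_bigsetU_EFin.
- rewrite sum_fine// => k _; apply: integrable_fin_num => //.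
  exact: measurable_cell.
- by move=> k; exact: measurable_cell.
- exact: index_enum_uniq.
- exact: sub_trivIset (trivIset_cell hgrid).
- by rewrite (bigcup_cell hgrid ab); exact/measurable_EFinP.
Qed.

Lemma density_measurable l : `[a, b]%classic l -> measurable_fun `[a, b]%classic (g l).
Proof. by move=> /density_integrable/measurable_int/measurable_EFinP. Qed.

Lemma density_integrable_cell l (k : 'I_N) : `[a, b]%classic l ->
  mu.-integrable (cell h k) (EFin \o g l).
Proof.
move=> lab; apply: integrableS (density_integrable lab) => //.
- exact: measurable_cell.
- exact: (cell_subset hgrid).
Qed.

Lemma cell_prob_ge0 l (k : 'I_N) : `[a, b]%classic l -> 0 <= cell_prob mu g h k l.
Proof.
case: hg => _ g0 _ lab; apply: Rintegral_ge0 => t /(cell_subset hgrid) tab.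
exact: g0.
Qed.

Lemma sum_cell_prob l : `[a, b]%classic l -> \sum_(k < N) cell_prob mu g h k l = 1.
Proof.
move=> lab; rewrite -Rintegral_cells; last 2 first.
- exact: density_measurable.
- by move=> k; exact: density_integrable_cell.
by case: hg => _ _ g1; rewrite /Rintegral g1.
Qed.

Lemma calE_step_mx n (Ps : 'I_N -> 'M[R]_n) l : `[a, b]%classic l ->
  calE `[a, b]%classic mu g (step_mx h Ps) l = \sum_k cell_prob mu g h k l *: Ps k.
Proof.
move=> lab; apply/matrixP => i j; rewrite mxE summxE.
have cellE (k : 'I_N) : {in cell h k, (fun t => g l t * step_mx h Ps t i j) =1
    (fun t => g l t * Ps k i j)}.
  by move=> t /set_mem tk; rewrite (step_mx_cell hgrid _ tk).
rewrite Rintegral_cells.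
- apply: eq_bigr => k _; rewrite mxE (eq_Rintegral mu (@cellE k)) RintegralZr//.
    exact: measurable_cell.
  exact: density_integrable_cell.
- apply: measurable_funM; first exact: density_measurable.
  exact: measurable_step_mx.
- move=> k; have mk := measurable_cell h k.
  apply: (eq_integrable mk (fun t => (g l t)%:E * (Ps k i j)%:E)%E).
    by move=> t /cellE /= ->; rewrite EFinM.
  by apply: integrableZr => //; exact: density_integrable_cell.
Qed.

Lemma Qmat_Upsilon n (Ps : 'I_N -> 'M[R]_n) l : `[a, b]%classic l ->
  Qmat mu g n N h l *m Upsilon Ps *m (Qmat mu g n N h l)^T =
  \sum_k cell_prob mu g h k l *: Ps k.
Proof.
move=> lab; rewrite /Qmat /Upsilon mul_mxrow_mxdiag tr_mxrow mul_mxrow_mxcol.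
apply: eq_bigr => k _; rewrite tr_scalar_mx mul_scalar_mx mul_mx_scalar scalerA.
by rewrite -expr2 sqr_sqrtr// cell_prob_ge0.
Qed.

(** The weights are nonnegative and sum to 1, so they cannot all vanish. This is what makes the
    combination strictly positive. *)
Lemma pos_def_calE n (Ps : 'I_N -> 'M[R]_n) l : `[a, b]%classic l ->
  (forall k, pos_def (Ps k)) -> pos_def (\sum_k cell_prob mu g h k l *: Ps k).
Proof.
move=> lab Ppos; split.
  by rewrite raddf_sum/=; apply: eq_bigr => k _; rewrite linearZ/= (Ppos k).1.
move=> x x0.
have -> : quad_form (\sum_k cell_prob mu g h k l *: Ps k) x =
    \sum_k cell_prob mu g h k l * quad_form (Ps k) x.
  rewrite quad_formE mulmx_suml /dotp mulmx_sumr summxE; apply: eq_bigr => k _.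
  by rewrite -scalemxAl -/(dotp _ _) dotpZr quad_formE.
have term0 k : 0 <= cell_prob mu g h k l * quad_form (Ps k) x.
  by rewrite mulr_ge0 ?cell_prob_ge0// ltW// (Ppos k).2.
rewrite lt_def sumr_ge0 ?andbT//; apply/eqP => /psumr_eq0P s0.
have : \sum_(k < N) cell_prob mu g h k l = 0.
  rewrite big1// => k _; have /eqP := s0 (fun k _ => term0 k) k isT.
  by rewrite mulf_eq0 [X in _ || X]gt_eqF ?orbF ?(Ppos k).2// => /eqP.
by rewrite sum_cell_prob// => /eqP; rewrite oner_eq0.
Qed.

End StepIntegrals.

(** * Uniform constants over the finitely many cells, and the conclusion *)

Lemma finite_lower_bound (R : realType) (I : finType) (p : I -> R -> Prop) :
  (forall i c c', c' <= c -> p i c -> p i c') ->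
  (forall i, exists2 c, 0 < c & p i c) -> exists2 c, 0 < c & forall i, p i c.
Proof.
move=> pdown pex.
have /choice[f fP] : forall i, exists c, 0 < c /\ p i c.
  by move=> i; have [c c0 pc] := pex i; exists c.
(* Starting the minimum at 1 keeps it positive for an empty index type as well. *)
exists (\big[Order.min/1]_i f i) => [|i].
  by apply: lt_bigmin; rewrite ?ltr01// => i _; exact: (fP i).1.
by apply: pdown (fP i).2; exact: bigmin_le_cond.
Qed.

Lemma pos_semidef_subW (R : realType) n (M : 'M[R]_n) c c' : c' <= c ->
  pos_semidef (M - c%:M) -> pos_semidef (M - c'%:M).
Proof.
move=> cc' [MT M0]; have {}MT : M^T = M.
  by move: MT; rewrite linearB/= tr_scalar_mx => /addIr.
split; first by rewrite linearB/= tr_scalar_mx MT.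
move=> x; apply: le_trans (M0 x) _; rewrite !quad_formB_scalar lerD2l lerN2.
by rewrite ler_wpM2r// dotp_ge0.
Qed.

Lemma Hinf_pos_step_mx (R : realType) (a b : R) N (h : nat -> R) n
    (mu : {measure set (measurableTypeR R) -> \bar R}) (Ps : 'I_N -> 'M[R]_n) :
  a < b -> is_grid a b N h -> (forall k, pos_def (Ps k)) ->
  Hinf_pos (`[a, b]%classic : set (measurableTypeR R)) mu (step_mx h Ps).
Proof.
move=> ab hgrid Ppos; split; first split.
- by move=> i j; exact: measurable_step_mx.
(* A crude bound valid at every point; the absolute values allow terms to be discarded without
   knowing the sign of [spectral_norm]. *)
- apply: (@le_lt_trans _ _ (\sum_k `|spectral_norm (Ps k)|)%:E); last exact: ltry.
  apply/ess_supP; apply: nearW => l; rewrite /patch.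
  case: ifP => [/set_mem|_]; last first.
    by rewrite lee_fin sumr_ge0.
  rewrite /= in_itv/= => /(cell_cover hgrid ab)[k lk].
  rewrite (step_mx_cell hgrid _ lk) lee_fin (bigD1 k)//=.
  by rewrite ler_wpDr ?sumr_ge0// ler_norm.
- by move=> l _; apply: step_mx_sym => k; exact: (Ppos k).1.
- have [k|c c0 cP] := @finite_lower_bound R 'I_N (fun k c => pos_semidef (Ps k - c%:M))
      (fun k c c' => @pos_semidef_subW R n (Ps k) c c').
    have [c c0 cP] := pos_def_coercive (Ppos k); exists c => //.
    split; first by rewrite linearB/= tr_scalar_mx (Ppos k).1.
    by move=> x; rewrite quad_formB_scalar subr_ge0.
  exists c => //; apply: nearW => l; rewrite /= in_itv/=.
  by move=> /(cell_cover hgrid ab)[k lk]; rewrite (step_mx_cell hgrid _ lk).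
Qed.

Theorem proposition7 (R : realType) (a b : R) (hab : a < b)
  (Theta : set (measurableTypeR R)) (hTheta : Theta = `[a, b]%classic)
  (mu : {measure set (measurableTypeR R) -> \bar R})
  (hmu : sigma_finite Theta mu)
  (n r : nat)
  (A : R -> 'M[R]_n) (B : R -> 'M[R]_(n, r)) (C : R -> 'M[R]_(r, n))
  (hA : Hinf Theta mu A) (hB : Hinf Theta mu B) (hC : Hinf Theta mu C)
  (nu0 : R -> R)
  (hnu0m : measurable_fun Theta nu0)
  (hnu0 : {ae mu, forall l, Theta l -> 0 < nu0 l})
  (g : R -> R -> R) (hg : transition_density Theta mu g)
  (hgpos : {ae mu, forall l, Theta l ->
     (0 < \int[mu]_(t in Theta) (g t l)%:E)%E})
  (d : measure_display) (W : measurableType d) (Pr : probability W R)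
  (vartheta : nat -> {RV Pr >-> measurableTypeR R})
  (hchain : markov_chain Theta mu nu0 g vartheta)
  (N : nat) (h : nat -> R) (hgrid : is_grid a b N h)
  (hbar : 'I_N -> R) (hhbar : forall i, cell h i (hbar i))
  (gamma : R) (hgamma : 0 < gamma)
  (sA sB sC sQ : 'I_N -> R)
  (hs : forall i, [/\ 0 < sA i, 0 < sB i, 0 < sC i & 0 < sQ i])
  (hdist : forall i, {ae mu, forall l, cell h i l ->
     [/\ spectral_norm (A l - A (hbar i)) <= sA i,
         spectral_norm (B l - B (hbar i)) <= sB i,
         spectral_norm (C l - C (hbar i)) <= sC i &
         spectral_norm (Qmat mu g n N h l - Qmat mu g n N h (hbar i)) <= sQ i]})
  (hLMI : LMI_feasible gamma sA sB sC sQ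
     (fun i => A (hbar i)) (fun i => B (hbar i)) (fun i => C (hbar i))
     (fun i => Qmat mu g n N h (hbar i))) :
  exists P : R -> 'M[R]_n,
    Hinf_pos Theta mu P /\
    unif_pos Theta mu (Xi Theta mu gamma g A B C P).
Proof.
move: hLMI => [X [Ps [al [be [rho LMI]]]]].
have Ppos k : pos_def (Ps k) by have [] := LMI k.
have PT k : (Ps k)^T = Ps k := (Ppos k).1.
have UpsT : (Upsilon Ps)^T = Upsilon Ps.
  by rewrite /Upsilon tr_mxdiag; apply/eq_mxdiag => k; rewrite PT.
subst Theta; exists (step_mx h Ps).
split; first exact: Hinf_pos_step_mx.
(* One [xi] serves every point where the four distance bounds hold, so null sets are left to the
   very end. *)
have [xi xi0 xiP] : exists2 xi : R, 0 < xi & forall i l, cell h i l ->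
    [/\ spectral_norm (A l - A (hbar i)) <= sA i,
        spectral_norm (B l - B (hbar i)) <= sB i,
        spectral_norm (C l - C (hbar i)) <= sC i &
        spectral_norm (Qmat mu g n N h l - Qmat mu g n N h (hbar i)) <= sQ i] ->
    pos_semidef (Xi `[a, b]%classic mu gamma g A B C (step_mx h Ps) l - xi%:M).
  apply: finite_lower_bound => [i c c' cc' cP l li dl|i].
    exact: pos_semidef_subW cc' (cP l li dl).
  have [Xu _ [al0 be0 rho0] /pos_def_coercive[c c0 cP]] := LMI i.
  have [sA0 sB0 sC0 _] := hs i.
  (* The constant of [Xi_form_bound], with [c] the coercivity constant of [Pi1] for cell [i]. *)
  exists (c / (1 + frob2 (X i)^T)).
    by rewrite divr_gt0// ltr_pwDl// frob2_ge0.
  move=> l li [dA dB dC dQ]; have lab := cell_subset hgrid li.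
  have EE := calE_step_mx hab hgrid hg Ps lab.
  have Epos := pos_def_calE hab hgrid hg lab Ppos; rewrite -EE in Epos.
  split.
    rewrite linearB/= tr_scalar_mx Xi_sym//; first exact: Epos.1.
    exact: step_mx_sym.
  move=> v; rewrite -[v]vsubmxK -[dsubmx v]vsubmxK -[dsubmx (dsubmx v)]vsubmxK.
  rewrite quad_formB_scalar quad_form_Xi subr_ge0 !dotp_col !addrA.
  rewrite (step_mx_cell hgrid _ li).
  apply: (Xi_form_bound sA0 sB0 sC0 al0 be0 rho0 (ltW c0) UpsT Xu dA dB dC dQ cP Epos).
  by rewrite EE (Qmat_Upsilon hgrid hg).
exists xi => //.
(* There are finitely many cells, so almost every [l] satisfies all the distance conditions at
   once. *)
apply: (filterS _ (filter_forall _ hdist)) => l dl; rewrite /= in_itv/=.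
by move=> /(cell_cover hgrid hab)[i li]; exact: xiP (dl i li).
Qed.
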